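(* Let $G$ and $H$ be two finite simple digraphs with $n(H)\geq 2$. Then (i) $\gamma_I(G\overrightarrow{\circ} H)=2n(G)$, and (ii) \[ r_I(G\overrightarrow{\circ} H)=\begin{cases} 0 & \text{if } n(G)=1,\\ n(H) & \text{if } G \text{ has no arcs and } n(G)\geq 2,\\ n(H)-1 & \text{otherwise.}\end{cases}\]
   Context: $n(D)$ denotes the number of vertices of a digraph $D$. For digraphs $G$ and $H$ with $V(G)=\{v_1,\dots,v_{n(G)}\}$, the corona $G\overrightarrow{\circ} H$ is formed from one copy of $G$ and $n(G)$ vertex-disjoint copies $H_1,\dots,H_{n(G)}$ of $H$ by adding an arc from $v_i$ to every vertex of $H_i$, for each $i$. An Italian dominating function (IDF) on a digraph $D$ is a function $f:V(D)\to\{0,1,2\}$ such that every vertex $v$ with $f(v)=0$ has at least two in-neighbors $w$ with $f(w)=1$ or at least one in-neighbor $w$ with $f(w)=2$; its weight is $\sum_u f(u)$ and $\gamma_I(D)$ is the minimum weight of an IDF. For a set $R$ of arcs not in $A(D)$ (between distinct vertices), $D+R$ is $D$ with these arcs added; $R$ is an Italian reinforcement set if $\gamma_I(D+R)<\gamma_I(D)$. The Italian reinforcement number $r_I(D)$ is the minimum size of such a set, defined to be $0$ if $\gamma_I(D)\leq 2$. *)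

(* Defs.v *)
From mathcomp Require Import all_boot.

Set Implicit Arguments.
Unset Strict Implicit.
Unset Printing Implicit Defensive.

(* A finite simple digraph is a finite vertex type T with an irreflexive arc  *)
(* relation e : rel T; e u v is the arc from u to v, and opposite arcs u -> v *)
(* and v -> u may coexist.                                                    *)

Definition corona (G H : finType) (eG : rel G) (eH : rel H) :
    rel (G + G * H)%type :=
  fun x y =>
    match x, y with
    | inl u, inl v => eG u v
    | inl u, inr (v, _) => u == v
    | inr (u, h), inr (v, k) => (u == v) && eH h k
    | inr _, inl _ => false
    end.

Section ItalianDomination.

Variables (T : finType) (e : rel T).
Implicit Types (f : {ffun T -> 'I_3}) (R : {set T * T}).

Definition idf f : bool :=
  [forall v, (f v == 0 :> nat) ==>
     ((2 <= #|[set w | e w v & f w == 1 :> nat]|)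
      || [exists w, e w v && (f w == 2 :> nat)])].

Definition weight f : nat := \sum_(u : T) f u.

(* The minimum exists because the constant function 2 is an IDF. *)
Definition gamma_I : nat :=
  weight [arg min_(f < [ffun=> ord_max] | idf f) weight f].

Definition nonarcs : {set T * T} := [set p | (p.1 != p.2) && ~~ e p.1 p.2].

Definition add_arcs R : rel T := fun u v => e u v || ((u, v) \in R).

End ItalianDomination.

Definition reinforcement_set (T : finType) (e : rel T) (R : {set T * T}) :
    bool :=
  (R \subset nonarcs e) && (gamma_I (add_arcs e R) < gamma_I e).

(* The minimum in the second branch exists because adding all missing arcs    *)
(* gives a digraph with gamma_I <= 2: see reinforcement_set_nonarcs.          *)
Definition r_I (T : finType) (e : rel T) : nat :=
  if gamma_I e <= 2 then 0
  else #|[arg min_(R < nonarcs e | reinforcement_set e R) #|R|]|.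

Lemma idf_const2 (T : finType) (e : rel T) : idf e [ffun=> ord_max].
Proof. by apply/forallP=> v; rewrite ffunE. Qed.

Lemma gamma_I_le (T : finType) (e : rel T) (f : {ffun T -> 'I_3}) :
  idf e f -> gamma_I e <= weight f.
Proof.
by rewrite /gamma_I; case: arg_minnP => [|g _ gmin /gmin]; first exact: idf_const2.
Qed.

Lemma gamma_I_attained (T : finType) (e : rel T) :
  exists2 f : {ffun T -> 'I_3}, idf e f & weight f = gamma_I e.
Proof.
rewrite /gamma_I; case: arg_minnP => [|g gP _]; first exact: idf_const2.
by exists g.
Qed.

Lemma reinforcement_set_nonarcs (T : finType) (e : rel T) :
  2 < gamma_I e -> reinforcement_set e (nonarcs e).
Proof.
move=> gt2; rewrite /reinforcement_set subxx /=; apply: leq_ltn_trans gt2.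
have [x _|T0] := pickP (@predT T); last first.
  apply: leq_trans (gamma_I_le (idf_const2 _)) _.
  by rewrite /weight big1 // => x; have := T0 x.
pose f : {ffun T -> 'I_3} := [ffun y => if y == x then ord_max else ord0].
have /gamma_I_le/leq_trans -> // : idf (add_arcs e (nonarcs e)) f.
  apply/forallP=> v; apply/implyP; rewrite ffunE; case: (eqVneq v x) => // vx _.
  apply/orP; right; apply/existsP; exists x; rewrite ffunE eqxx andbT.
  by rewrite /add_arcs inE /= (eq_sym x) vx /= orbN.
rewrite /weight (bigD1 x) //= ffunE eqxx big1 // => y /negPf yx.
by rewrite ffunE yx.
Qed.

(* Main.v *)
(* Partition the corona into blocks, the i-th one consisting of v_i and H_i.   *)
(* If a block has weight at most 1, it has at least n(H) vertices of value 0,  *)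
(* and the old arcs dominate none of them, except possibly v_i through an arc  *)
(* of G; each of the others needs a new arc of its own.  With no new arcs      *)
(* every block therefore weighs at least 2.  Conversely, given u <> v in G, the *)
(* value 2 on G - v and 1 on a single vertex h of H_v has weight 2 n(G) - 1,    *)
(* and becomes Italian dominating once u points to all the rest of block v.    *)

Require Import Defs.
From mathcomp Require Import all_boot.

Set Implicit Arguments.
Unset Strict Implicit.
Unset Printing Implicit Defensive.

(** The whole argument rests on [light_block_card]. A function of weight below 2 n(G) leaves some
    block with weight at most 1 ([idf_light_block]). If it is an IDF after adding [R], this forces
    n(H) <= |R| + 1, and even n(H) <= |R| when no arc of [G] enters the root of that block. With [R]
    empty this contradicts n(H) >= 2, whence [gamma_I_corona]; for a reinforcement set it is the
    lower bound [reinforcement_corona_ge]. The construction in [reinforcement_corona_ex] meets that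
    bound. *)

Section ItalianDomination.

Variable T : finType.
Implicit Types (e : rel T) (f : {ffun T -> 'I_3}) (R : {set T * T}).

Lemma eq_idf e e' f : e =2 e' -> idf e f = idf e' f.
Proof.
move=> ee'; apply: eq_forallb => v; congr (_ ==> (_ || _)).
  by congr (_ <= #|pred_of_set _|); apply/setP=> w; rewrite !inE ee'.
by apply: eq_existsb => w; rewrite ee'.
Qed.

Lemma idf_sum_ge2 e f v :
  idf e f -> f v = 0 :> nat -> 2 <= \sum_(w | e w v) f w.
Proof.
move=> /forallP/(_ v)/implyP fP fv0.
have /orP[le2|/existsP[w /andP[ewv /eqP fw2]]] := fP (introT eqP fv0); last first.
  by rewrite (bigD1 w) //= fw2.
apply: leq_trans le2 _; rewrite -sum1_card big_mkcond [leqRHS]big_mkcond.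
by apply: leq_sum => w _; rewrite inE; case: (e w v) => //=; case: eqP => // ->.
Qed.

(** A vertex of value 0 with old in-weight at most 1 must be the head of an arc of [R], so the heads
    of [R] cover all such vertices. *)
Lemma card_undominated_le e R f :
    idf (add_arcs e R) f ->
  #|[set x | (f x == 0 :> nat) && (\sum_(w | e w x) f w <= 1)]| <= #|R|.
Proof.
move=> fP; apply: leq_trans (leq_imset_card snd R); apply/subset_leq_card.
apply/subsetP=> x; rewrite inE => /andP[/eqP fx0 le1].
have [w wxR|noR] := pickP [pred w | (w, x) \in R].
  by apply/imsetP; exists (w, x).
have := idf_sum_ge2 fP fx0; rewrite (eq_bigl (e^~ x)) => [|w].
  by rewrite ltnNge le1.
by rewrite /add_arcs; have /= -> := noR w; rewrite orbF.
Qed.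

Lemma r_I_le e R : reinforcement_set e R -> r_I e <= #|R|.
Proof.
rewrite /r_I; case: (leqP (gamma_I e) 2) => // gt2 RP.
case: arg_minnP => [|S _ Smin]; first exact: reinforcement_set_nonarcs.
exact: Smin.
Qed.

Lemma r_I_attained e :
  2 < gamma_I e -> exists2 R, reinforcement_set e R & r_I e = #|R|.
Proof.
rewrite /r_I ltnNge => /[dup] + /negPf->; rewrite -ltnNge => gt2.
case: arg_minnP => [|S SP _]; first exact: reinforcement_set_nonarcs.
by exists S.
Qed.

End ItalianDomination.

Section Corona.

Variables (G H : finType) (eG : rel G) (eH : rel H).
Let V := (G + G * H)%type.
Let D : rel V := corona eG eH.
Implicit Types (f : {ffun V -> 'I_3}) (R : {set V * V}).

Definition root (x : V) : G := match x with inl u => u | inr p => p.1 end.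

Lemma weight_blocks f : weight f = \sum_i \sum_(x | root x == i) f x.
Proof. by rewrite /weight (partition_big root predT). Qed.

Lemma card_block i : #|[set x | root x == i]| = #|H|.+1.
Proof.
have -> : [set x | root x == i] = inl i |: [set inr (i, h) | h : H].
  apply/setP=> -[w|[w h]]; rewrite !inE /root.
    have -> : (inl w == inl i :> V) = (w == i) by [].
    by case: imsetP => [[]|] // _; rewrite orbF.
  have -> : (inr (w, h) == inl i :> V) = false by [].
  by apply/idP/imsetP=> [/eqP/= ->|[k _ [-> _]]]; [exists h | exact: eqxx].
rewrite cardsU1 card_imset; last by move=> h k [].
by rewrite (_ : inl i \notin _) //; apply/negP=> /imsetP[].
Qed.

Lemma light_block_zeros f i : \sum_(x | root x == i) f x <= 1 ->
  #|H| <= #|[set x | (root x == i) && (f x == 0 :> nat)]|.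
Proof.
move=> le1; rewrite -ltnS -(card_block i) -addn1.
apply: leq_trans (leq_add (leqnn _) le1).
rewrite -!sum1_card (eq_bigl (fun x => root x == i)) => [|x]; last by rewrite inE.
rewrite [X in _ <= X + _](eq_bigl (fun x => (root x == i) && (f x == 0 :> nat))); last first.
  by move=> x; rewrite inE.
(* Pointwise, 1 is at most [f x = 0] + f x. *)
rewrite [X in _ <= X + _]big_mkcondr -big_split /=; apply: leq_sum => x _.
by case: (f x : nat).
Qed.

(** No arc of the corona enters a copy of [H] from another block. *)
Lemma leq_in_weight f x : (forall u, x != inl u) ->
  \sum_(w | D w x) f w <= \sum_(y | root y == root x) f y.
Proof.
case: x => [u /(_ u)/eqP//|[u h] _ /=].
rewrite big_mkcond [leqRHS]big_mkcond; apply: leq_sum => -[w|[w k]] _ //=.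
by case: (w == u) => //=; case: (eH k h).
Qed.

Lemma light_block_card f R i :
    idf (add_arcs D R) f -> \sum_(x | root x == i) f x <= 1 ->
  #|H| <= #|R| + [exists u, eG u i].
Proof.
move=> fP le1; apply: leq_trans (light_block_zeros le1) _.
set Z := [set x | _]; rewrite addnC (cardsD1 (inl i) Z).
have ZP x : x \in Z -> x != inl i ->
    (f x == 0 :> nat) && (\sum_(w | D w x) f w <= 1).
  rewrite inE => /andP[/eqP rx ->] xi /=; apply: leq_trans le1.
  rewrite -rx; apply: leq_in_weight => u; apply: contra_neq xi => xu.
  by rewrite -rx xu.
have subD1 : #|Z :\ inl i| <= #|R|.
  apply: leq_trans (card_undominated_le fP); apply/subset_leq_card/subsetP=> x.
  by rewrite !inE => /andP[xi xZ]; apply: ZP; rewrite ?inE.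
(* An arc of [G] into [i] may dominate the root, so one zero is given up. Otherwise the root has no
   old in-neighbor and, if it has value 0, needs a new arc as well. *)
have [_|noarc] := boolP [exists u, eG u i]; first by rewrite leq_add ?leq_b1.
rewrite add0n -cardsD1; apply: leq_trans (card_undominated_le fP).
apply/subset_leq_card/subsetP=> x xZ; rewrite inE.
have [xi|/(ZP x xZ)//] := eqVneq x (inl i).
move: xZ; rewrite xi inE /= eqxx /= => -> /=.
rewrite big_pred0 // => -[w|[w k]] //=; apply/negP=> ewi.
by case/existsP: noarc; exists w.
Qed.

Lemma idf_light_block f : weight f < 2 * #|G| ->
  exists i, \sum_(x | root x == i) f x <= 1.
Proof.
move=> ltw; apply/existsP; apply: contraLR ltw => /existsPn heavy.
rewrite -leqNgt weight_blocks mulnC -sum_nat_const.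
by apply: leq_sum => i _; rewrite ltnNge heavy.
Qed.

Lemma gamma_I_corona : 2 <= #|H| -> gamma_I D = 2 * #|G|.
Proof.
move=> H2; apply/eqP; rewrite eqn_leq; apply/andP; split.
  pose f : {ffun V -> 'I_3} := [ffun x => if x is inl _ then ord_max else ord0].
  have /gamma_I_le/leq_trans -> // : idf D f.
    apply/forallP=> -[u|[u h]]; apply/implyP; rewrite ffunE // => _.
    by apply/orP; right; apply/existsP; exists (inl u); rewrite ffunE /= eqxx.
  rewrite /weight big_sumType /= [X in _ + X]big1 => [|p _]; last by rewrite ffunE.
  by rewrite (eq_bigr (fun=> 2)) => [|u _]; rewrite ?ffunE // sum_nat_const addn0 mulnC.
have [f fP <-] := gamma_I_attained D.
rewrite leqNgt; apply/negP=> /idf_light_block[i /light_block_card le].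
have /le : idf (add_arcs D set0) f.
  by rewrite -(eq_idf f (e := D)) // => x y; rewrite /add_arcs inE orbF.
rewrite cards0 add0n => /(leq_trans H2).
by case: [exists _, _].
Qed.

Lemma reinforcement_corona_ge R : 2 <= #|H| -> reinforcement_set D R ->
  #|H| <= #|R| + [exists v, exists u, eG u v].
Proof.
move=> H2 /andP[_]; rewrite gamma_I_corona //.
have [f fP <-] := gamma_I_attained (add_arcs D R).
case/idf_light_block => i /(light_block_card fP) /leq_trans -> //.
rewrite leq_add2l; case: (boolP [exists u, eG u i]) => // ei.
by rewrite (_ : [exists v, _]) //; apply/existsP; exists i.
Qed.

(** The summand [eG u v] is the arc saved when [u] already dominates [v] in [G], so both nonzero
    values of the reinforcement number come from one bound. *)
Lemma reinforcement_corona_ex u v : 2 <= #|H| -> u != v ->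
  exists2 R, reinforcement_set D R & #|R| + eG u v <= #|H|.
Proof.
move=> H2 uv; have /card_gt0P[h0 _] : 0 < #|H| by apply: leq_trans H2.
(* Heads of the new arcs from [inl u]; [inr (v, h0)] will carry value 1 and needs no domination. *)
pose S := [set y : V | [&& root y == v, y != inr (v, h0) & ~~ D (inl u) y]].
exists [set (inl u : V, y) | y in S]; last first.
  rewrite card_imset; last by move=> y z [].
  (* The block without [inr (v, h0)] has n(H) vertices; its root is split off because it lies
     outside [S] when [eG u v] holds. *)
  have := card_block v; rewrite (cardsD1 (inr (v, h0))) inE eqxx => -[<-].
  rewrite [leqRHS](cardsD1 (inl v)) !inE eqxx /= addnC.
  case euv: (eG u v); rewrite (leq_add2l 1) || rewrite add0n.
    apply/subset_leq_card/subsetP=> y; rewrite !inE => /and3P[-> -> nD].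
    by rewrite !andbT; apply: contraNneq nD => ->.
  rewrite (leq_trans (_ : _ <= #|[set x | root x == v] :\ inr (v, h0)|)) //.
    by apply/subset_leq_card/subsetP=> y; rewrite !inE => /and3P[-> ->].
  by rewrite [leqLHS](cardsD1 (inl v)) !inE eqxx.
rewrite /reinforcement_set gamma_I_corona //; apply/andP; split.
  apply/subsetP=> p /imsetP[y]; rewrite !inE => /and3P[/eqP ry _ nD] -> /=.
  by rewrite nD andbT; apply: contra_neq uv => uy; rewrite -ry -uy.
pose f : {ffun V -> 'I_3} := [ffun x => match x with
  | inl w => if w == v then ord0 else ord_max
  | inr p => if p == (v, h0) then inord 1 else ord0 end].
have fu : f (inl u) = ord_max by rewrite ffunE (negPf uv).
have /gamma_I_le/leq_ltn_trans -> // : idf (add_arcs D [set (inl u : V, y) | y in S]) f.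
  apply/forallP=> x; apply/implyP=> fx0; apply/orP; right; apply/existsP.
  have [/eqP rx|rx] := boolP (root x == v).
    exists (inl u); rewrite fu andbT /add_arcs.
    have [//|nD] := boolP (D (inl u) x); apply: imset_f; rewrite inE rx nD eqxx andbT /=.
    by apply: contraTneq fx0 => ->; rewrite ffunE eqxx inordK.
  case: x fx0 rx => [w|[w h]] /=; rewrite ffunE => + wv.
    by rewrite (negPf wv).
  by exists (inl w); rewrite /add_arcs ffunE /= eqxx (negPf wv).
(* The weight is 2 (n(G) - 1) + 1. *)
rewrite /weight big_sumType /= (bigD1 v) //= ffunE eqxx add0n.
rewrite (eq_bigr (fun=> 2)) => [|w /negPf wv]; last by rewrite ffunE wv.
rewrite sum_nat_const (bigD1 (v, h0)) //= ffunE eqxx inordK //.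
rewrite big1 => [|p /negPf pv]; last by rewrite ffunE pv.
have G0 : 0 < #|G| by apply/card_gt0P; exists v.
by rewrite (cardC1 v) addn0 addn1 -[in ltnRHS](prednK G0) [_ * 2]mulnC [2 * _.+1]mulnS.
Qed.

End Corona.

Theorem theorem4p7 (G H : finType) (eG : rel G) (eH : rel H)
    (G_simple : irreflexive eG) (H_simple : irreflexive eH)
    (G_nonempty : 1 <= #|G|) (H_ge2 : 2 <= #|H|) :
  gamma_I (corona eG eH) = 2 * #|G| /\
  r_I (corona eG eH) =
    if #|G| == 1 then 0
    else if [forall u, forall v, ~~ eG u v] && (2 <= #|G|) then #|H|
    else #|H| - 1.
Proof.
have gammaE := gamma_I_corona eG eH H_ge2; split=> //.
case: eqVneq => [G1|Gneq1]; first by rewrite /r_I gammaE G1.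
have G2 : 2 <= #|G| by rewrite ltn_neqAle eq_sym Gneq1.
have gt2 : 2 < gamma_I (corona eG eH).
  by rewrite gammaE (leq_trans _ (leq_mul (leqnn 2) G2)).
have [R RP rE] := r_I_attained gt2.
have geR := reinforcement_corona_ge H_ge2 RP; rewrite -rE in geR.
have leR u v : u != v -> r_I (corona eG eH) + eG u v <= #|H|.
  move=> uv; have [S SP] := reinforcement_corona_ex eG eH H_ge2 uv.
  by apply: leq_trans; rewrite leq_add2r r_I_le.
rewrite G2 andbT; apply/eqP; case: ifPn => [/forallP noarc|].
  (* Without arcs, any two distinct vertices give the upper bound n(H). *)
  have /card_gt1P[u [v [_ _ uv]]] := G2.
  rewrite eqn_leq (leq_trans (leq_addr _ _) (leR u v uv)).
  move: geR; rewrite (_ : [exists v, _] = false) ?addn0 //.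
  apply/negbTE/existsPn=> w; apply/existsPn=> x.
  exact: (forallP (noarc x)).
case/forallPn=> u /forallPn[v]; rewrite negbK => euv.
have uv : u != v by apply: contraTneq euv => ->; rewrite G_simple.
have := leR u v uv; rewrite euv => le; rewrite eqn_leq leq_subLR addnC.
rewrite (leq_trans geR) ?leq_add2l ?leq_b1 // andbT.
by rewrite -(leq_add2r 1) subnK // ltnW.
Qed.
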